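(* Let $(W,S)$ be a Coxeter system and $\theta$ an involutive automorphism of $(W,S)$ having the NOF property. Then the subposet $\mathrm{Br}(\iota(\theta))$ of the Bruhat order on $W$ induced by the set of twisted identities $\iota(\theta)=\{\theta(w)w^{-1}\mid w\in W\}$ is a pircon.
   Context: An involutive automorphism of $(W,S)$ is a group automorphism $\theta$ of $W$ with $\theta(S)=S$ and $\theta^2=\mathrm{id}$. $\theta$ has the NOF (no odd flip) property if $s\theta(s)$ has even or infinite order for every $s\in S$ with $s\neq\theta(s)$. For $X\subseteq W$, $\mathrm{Br}(X)$ is the subposet of the Bruhat order on $W$ induced by $X$. Writing $\lessdot$ for the cover relation, a special partial matching (SPM) on a finite poset $Q$ with maximum $\hat1$ is a function $M:Q\to Q$ such that: $M^2=\mathrm{id}$; $M(\hat1)\lessdot\hat1$; for all $x\in Q$, $M(x)\lessdot x$, $M(x)=x$, or $x\lessdot M(x)$; and if $x\lessdot y$ and $M(x)\neq y$, then $M(x)<M(y)$. A poset $P$ is a pircon if for every non-minimal element $x\in P$ the principal order ideal $P_{\leq x}=\{y\in P\mid y\leq x\}$ is finite and admits an SPM. *)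

(* Defs.v *)
From HB Require Import structures.
From Stdlib Require Import Relations.
From mathcomp Require Import all_boot all_order.
From mathcomp Require Import boolp classical_sets functions cardinality.

Set Implicit Arguments.
Unset Strict Implicit.
Unset Printing Implicit Defensive.

Import Order.TTheory.

Local Open Scope classical_set_scope.
Local Open Scope order_scope.
Local Open Scope group_scope.

(* A finite or infinite poset is a set Q of elements of an ambient porderType,
   with the induced order; covers are those of the induced order. *)
Section Pircons.
Context {d : Order.disp_t} {T : porderType d}.
Implicit Types (P Q : set T) (x y : T).

Definition covers Q x y : Prop :=
  [/\ Q x, Q y, x < y & ~ exists z, [/\ Q z, x < z & z < y]].

Definition is_maximum Q x : Prop := Q x /\ ubound Q x.

(* M stands for its restriction to Q; its values outside Q are irrelevant. *)
Record special_partial_matching Q (M : T -> T) : Prop := SpecialPartialMatching {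
  spm_fun : set_fun Q Q M;
  spm_invol : forall x, Q x -> M (M x) = x;
  spm_max : exists2 top, is_maximum Q top & covers Q (M top) top;
  spm_cover : forall x, Q x -> [\/ covers Q (M x) x, M x = x | covers Q x (M x)];
  spm_lt : forall x y, covers Q x y -> M x <> y -> M x < M y
}.

Definition order_ideal P x : set T := [set y | P y /\ y <= x].

Definition nonminimal P x : Prop := P x /\ exists2 y, P y & y < x.

Definition pircon P : Prop := forall x, nonminimal P x ->
  finite_set (order_ideal P x) /\
  exists M, special_partial_matching (order_ideal P x) M.

End Pircons.

Section CoxeterSystems.
Context {W : groupType}.
Implicit Types (S X : set W) (m : W -> W -> nat) (u v w x : W) (a b : seq W).

Definition word_over S a : Prop := forall x, x \in a -> S x.

(* The entry 0 encodes infinity, so that the corresponding relator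
   (s t)^(m s t) is the empty word. *)
Definition coxeter_matrix S m : Prop := forall s t, S s -> S t ->
  m s t = m t s /\ (m s t = 1%N <-> s = t).

Definition relator m (s t : W) : seq W := flatten (nseq (m s t) [:: s; t]).

Inductive insertion S m : seq W -> seq W -> Prop :=
  Insertion a b s t of S s & S t : insertion S m (a ++ b) (a ++ relator m s t ++ b).

(* W is presented by the generators S and the relations (s t)^(m s t) = 1.
   As the words s s are among the relators, the quotient of the free monoid
   on S by insertions and deletions of relators is already the group with this
   presentation; no letters for inverses are needed. *)
Definition presented_by S m : Prop :=
  (forall w, exists2 a, word_over S a & \prod_(x <- a) x = w) /\
  (forall a b, word_over S a -> word_over S b ->
     \prod_(x <- a) x = \prod_(x <- b) x <->
     clos_refl_sym_trans _ (insertion S m) a b).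

Definition coxeter_system S : Prop :=
  exists m, coxeter_matrix S m /\ presented_by S m.

Definition has_expression S w (n : nat) : Prop :=
  exists a, [/\ word_over S a, size a = n & \prod_(x <- a) x = w].

(* The junk value 0 occurs only for w outside the submonoid generated by S. *)
Definition coxeter_length S w : nat :=
  if pselect (exists n, `[< has_expression S w n >]) is left exn
  then ex_minn exn else 0%N.

Definition reflections S : set W := [set w * s * w^-1 | w in setT & s in S].

Definition bruhat_step S u w : Prop :=
  (exists2 t, reflections S t & w = u * t) /\
  (coxeter_length S u < coxeter_length S w)%N.

Definition bruhat_le S : W -> W -> Prop := clos_refl_trans _ (bruhat_step S).

Definition has_order x (n : nat) : Prop :=
  [/\ (0 < n)%N, x ^+ n = 1 & forall k, (0 < k)%N -> x ^+ k = 1 -> (n <= k)%N].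

Definition infinite_order x : Prop := forall n, (0 < n)%N -> x ^+ n <> 1.

Definition involutive_automorphism S (theta : W -> W) : Prop :=
  [/\ {morph theta : x y / x * y}, theta @` S = S & involutive theta].

Definition no_odd_flip S (theta : W -> W) : Prop :=
  forall s, S s -> s <> theta s ->
    infinite_order (s * theta s) \/
    exists2 n, has_order (s * theta s) n & ~~ odd n.

Definition twisted_identities (theta : W -> W) : set W :=
  [set theta w * w^-1 | w in setT].

Lemma bruhat_le_length S u w : bruhat_le S u w ->
  u = w \/ (coxeter_length S u < coxeter_length S w)%N.
Proof.
elim=> {u w} [u w [_ lt_uw]|u|u v w _ [->|lt_uv] _ [<-|lt_vw]].
- by right.
- by left.
- by left.
- by right.
- by right.
- by right; apply: ltn_trans lt_vw.
Qed.

End CoxeterSystems.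

(* The carrier of W, ordered by the Bruhat order of (W, S) *)
Definition bruhat (W : groupType) (S : set W) : Type := W.

HB.instance Definition _ (W : groupType) (S : set W) :=
  Choice.copy (bruhat S) W.

Fact bruhat_display : Order.disp_t. Proof. exact: Order.Disp tt tt. Qed.

Section BruhatOrder.
Context {W : groupType} (S : set W).

Definition bruhat_leb (u w : bruhat S) : bool := `[< bruhat_le S u w >].

Fact bruhat_lexx : reflexive bruhat_leb.
Proof. by move=> u; apply/asboolP; apply: rt_refl. Qed.

Fact bruhat_le_anti : antisymmetric bruhat_leb.
Proof.
move=> u w /andP[/asboolP uw /asboolP wu].
case: (bruhat_le_length uw) => // luw; case: (bruhat_le_length wu) => // lwu.
by have := ltn_trans luw lwu; rewrite ltnn.
Qed.

Fact bruhat_le_trans : transitive bruhat_leb.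
Proof.
by move=> v u w /asboolP uv /asboolP vw; apply/asboolP; apply: rt_trans uv vw.
Qed.

HB.instance Definition _ := Order.Le_isPOrder.Build bruhat_display (bruhat S)
  bruhat_lexx bruhat_le_anti bruhat_le_trans.

(* A subset X of W with the order induced by the Bruhat order *)
Definition Br (X : set W) : set (bruhat S) := X.

End BruhatOrder.

Arguments Br {W} S X.

(* Main.v *)
(** For s in S put M_s(x) = theta(s) x s.  The claim is that, for s a right
    descent of a nontrivial twisted identity w, the map M_s is a special partial
    matching of the ideal below w.  A sign computation with the inversion cocycle
    shows that M_s moves every twisted identity having s as a descent, so the
    lifting property of the Bruhat order gives all the axioms but one case of the
    last: if s is an ascent of the twisted identities x and y with x < y, and
    M_s(x) > x but M_s(y) = y, lifting only yields M_s(x) <= y s.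

    That case is where odd flips must be excluded.  Writing y = theta(u) u^-1,
    the reflection u^-1 s u is fixed by theta; without odd flips it is conjugate,
    under an element fixed by theta, to a simple reflection fixed by theta.  Hence
    y s = theta(v) r v^-1 with r simple and theta(r) = r.  By induction on the
    length of y, descending y by twisted conjugation inside a rank 2 parabolic
    subgroup, every twisted identity below y s is then below y. *)

From Stdlib Require Import Relations.
Require Import Defs.
From mathcomp Require Import all_boot all_order.
From mathcomp Require Import boolp classical_sets functions cardinality.

Set Implicit Arguments.
Unset Strict Implicit.
Unset Printing Implicit Defensive.

Import Order.TTheory.

Local Open Scope classical_set_scope.
Local Open Scope group_scope.

(** * Inversions in a presented group *)

Ltac group_simp := rewrite ?invgM ?invgK ?mulgA;
  repeat progress rewrite ?mulgK ?mulgVK ?mulVg ?mulgV ?mulg1 ?mul1g ?invg1.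

Section WordsInInvolutions.
Context {W : groupType} (S : set W) (m : W -> W -> nat).
Context (matS : coxeter_matrix S m).
Context (presS : presented_by S m).
Implicit Types (s t u v w p : W) (a b : seq W).

Lemma word_cat a b : word_over S (a ++ b) <-> word_over S a /\ word_over S b.
Proof.
split=> [ab|[Sa Sb] x]; last by rewrite mem_cat => /orP[/Sa|/Sb].
by split=> x xab; apply: ab; rewrite mem_cat xab ?orbT.
Qed.

Lemma word_cons s a : word_over S (s :: a) <-> S s /\ word_over S a.
Proof.
rewrite -cat1s word_cat; split=> -[Ss Sa]; split=> //.
- by apply: Ss; rewrite mem_head.
- by move=> x; rewrite inE => /eqP->.
Qed.

Lemma word_nil : word_over S [::].
Proof. by []. Qed.

Lemma word_relator s t : S s -> S t -> word_over S (relator m s t).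
Proof.
move=> Ss St; rewrite /relator; elim: (m s t) => [|n IHn] //=.
by rewrite !word_cons.
Qed.

Lemma prod_relator s t : \prod_(x <- relator m s t) x = (s * t) ^+ m s t.
Proof.
rewrite /relator; elim: (m s t) => [|n IHn] /=; first by rewrite big_nil.
by rewrite !big_cons IHn expgS mulgA.
Qed.

Lemma relator1 s t : S s -> S t -> (s * t) ^+ m s t = 1.
Proof.
move=> Ss St; rewrite -prod_relator -[RHS](@big_nil _ _ *%g W predT id).
apply/(presS.2 _ _ (word_relator Ss St) word_nil); apply/rst_sym/rst_step.
by rewrite -[relator m s t]cats0; apply: (Insertion m [::] [::] Ss St).
Qed.

Lemma generator_sqr s : S s -> s * s = 1.
Proof.
move=> Ss; have := relator1 Ss Ss.
by rewrite ((matS Ss Ss).2.2 erefl) expg1.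
Qed.

(* Number, modulo 2, of the positions of a at which p can be read off: if v is
   the part of a after the letter s, this position yields v^-1 * s * v. *)
Fixpoint inv_parity a p : bool :=
  if a is s :: b then
    (p == (\prod_(x <- b) x)^-1 * s * \prod_(x <- b) x) (+) inv_parity b p
  else false.

Lemma inv_parity_cat a b p : inv_parity (a ++ b) p =
  inv_parity a (\prod_(x <- b) x * p * (\prod_(x <- b) x)^-1) (+) inv_parity b p.
Proof.
elim: a => [|s a IHa] //=; rewrite IHa addbA big_cat /=; congr (_ (+) _ (+) _).
set u := \prod_(x <- a) x; set v := \prod_(x <- b) x.
apply/eqP/eqP => [->|E]; first by group_simp.
by rewrite -[p in LHS](mulKg v) -[v * p](mulgVK v) E; group_simp.
Qed.

(** Counted from the right starting at 0, the letter at position [i] yields [(t * s) ^+ i * t]. *)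
Lemma inv_parity_alternating s t n p : S s -> S t ->
  inv_parity (flatten (nseq n [:: s; t])) p =
  odd (count (fun i => p == (t * s) ^+ i * t) (iota 0 n.*2)).
Proof.
move=> Ss St; elim: n => [|n IHn] //.
have sV x : S x -> x^-1 = x by move=> /generator_sqr/mulg1_eq.
have prodE : \prod_(x <- flatten (nseq n [:: s; t])) x = (s * t) ^+ n.
  elim: (n) => [|k IHk] /=; first by rewrite big_nil.
  by rewrite !big_cons IHk expgS mulgA.
have stV : ((s * t) ^+ n)^-1 = (t * s) ^+ n.
  by rewrite -expVgn invgM !sV.
have conjE k : (t * s) ^+ k * t * (s * t) ^+ k = (t * s) ^+ k.*2 * t.
  elim: k => [|k IHk]; first by rewrite !mulg1.
  transitivity (t * s * ((t * s) ^+ k * t * (s * t) ^+ k) * (s * t)).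
    by rewrite expgS [(s * t) ^+ _]expgSr !mulgA.
  by rewrite IHk doubleS expgS expgSr !mulgA.
rewrite doubleS -addn2 iotaD count_cat /= add0n addn0 IHn !oddD !oddb.
rewrite !big_cons prodE stV conjE invgM stV sV //.
rewrite addbA addbC; congr (_ (+) _); rewrite addbC; congr (_ (+) _).
congr (_ == _); rewrite expgS -[RHS]mulgA -conjE !mulgA -expgS expgSr.
by rewrite !mulgA.
Qed.

(** As [(t * s) ^+ m s t = 1], the second half of the list of reflections read off the relator
    repeats the first. *)
Lemma inv_parity_relator s t p : S s -> S t -> inv_parity (relator m s t) p = false.
Proof.
move=> Ss St; rewrite inv_parity_alternating //; set n := m s t.
have ts1 : (t * s) ^+ n = 1 by rewrite /n (matS Ss St).1 relator1.
have iotaE : iota n n = map (addn n) (iota 0 n) by rewrite -iotaDl addn0.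
rewrite -addnn iotaD count_cat add0n iotaE count_map.
rewrite (eq_count (a1 := preim _ _) (a2 := fun i => p == (t * s) ^+ i * t)).
  by rewrite addnn odd_double.
by move=> i /=; rewrite expgnDr ts1 mul1g.
Qed.

(** Turns invariants of words, checked on insertions of relators, into invariants of group
    elements. *)
Lemma word_eq_ind (P : seq W -> seq W -> Prop) a b :
  (forall a, P a a) -> (forall a b, P a b -> P b a) ->
  (forall a b c, P a b -> P b c -> P a c) ->
  (forall a b s t, S s -> S t -> P (a ++ b) (a ++ relator m s t ++ b)) ->
  word_over S a -> word_over S b -> \prod_(x <- a) x = \prod_(x <- b) x -> P a b.
Proof.
move=> Pr Ps Pt Pi Sa Sb /(presS.2 _ _ Sa Sb); elim=> {a b Sa Sb}.
- by move=> _ _ [*]; apply: Pi.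
- by [].
- by move=> a b _; apply: Ps.
- by move=> a b c _ + _; apply: Pt.
Qed.

Lemma inv_parity_prod a b p : word_over S a -> word_over S b ->
  \prod_(x <- a) x = \prod_(x <- b) x -> inv_parity a p = inv_parity b p.
Proof.
apply: (@word_eq_ind (fun a b => inv_parity a p = inv_parity b p)) => //.
- by move=> ? ? ? ->.
move=> {}a {}b s t Ss St; rewrite !inv_parity_cat inv_parity_relator //=.
by rewrite big_cat prod_relator relator1 //= mul1g.
Qed.

Lemma odd_size_prod a b : word_over S a -> word_over S b ->
  \prod_(x <- a) x = \prod_(x <- b) x -> odd (size a) = odd (size b).
Proof.
apply: (@word_eq_ind (fun a b => odd (size a) = odd (size b))) => //.
- by move=> ? ? ? ->.
move=> {}a {}b s t Ss St; rewrite !size_cat !oddD; congr (_ (+) _).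
suff -> : size (relator m s t) = (m s t).*2 by rewrite odd_double.
by rewrite /relator; elim: (m s t) => //= n ->.
Qed.

(** If [p = v^-1 * s * v] with [v] the product after the letter [s], then [s * v * p = v]:
    multiplying by [p] deletes that letter. *)
Lemma inv_parity_deletion a p : word_over S a -> inv_parity a p ->
  exists b, [/\ subseq b a, size b < size a & \prod_(x <- b) x = \prod_(x <- a) x * p].
Proof.
elim: a => [|s a IHa] // /word_cons[Ss Sa] /=.
case: eqP => [-> _|_ /=].
  exists a; split=> //; first exact: subseq_cons.
  by rewrite big_cons; group_simp; rewrite generator_sqr // mul1g.
move=> /(IHa Sa)[b [ba lt_ba E]]; exists (s :: b); split=> //.
- by rewrite /= eqxx.
- by rewrite !big_cons E mulgA.
Qed.

End WordsInInvolutions.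

(** * Length and descents *)

Section Length.
Context {W : groupType} (S : set W) (coxS : coxeter_system S).
Implicit Types (s t u v w x p q : W) (a b : seq W).
Local Notation len := (coxeter_length S).
Local Notation refl := (reflections S).

Lemma reduced_word w :
  exists a, [/\ word_over S a, size a = len w & \prod_(x <- a) x = w].
Proof.
have [m [_ [gen _]]] := coxS; have [a Sa Ea] := gen w.
rewrite /coxeter_length; case: pselect => [exn|[]].
  by case: ex_minnP => n /asboolP expn _; exact: expn.
by exists (size a); apply/asboolP; exists a.
Qed.

Lemma len_word a : word_over S a -> len (\prod_(x <- a) x) <= size a.
Proof.
move=> Sa; rewrite /coxeter_length; case: pselect => // exn.
by case: ex_minnP => n _; apply; apply/asboolP; exists a.
Qed.

Lemma odd_len_word a : word_over S a -> odd (len (\prod_(x <- a) x)) = odd (size a).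
Proof.
move=> Sa; have [m [mS pS]] := coxS.
have [b [Sb <- E]] := reduced_word (\prod_(x <- a) x).
exact: (odd_size_prod pS Sb Sa E).
Qed.

Lemma len1 : len 1 = 0%N.
Proof.
by have := len_word (@word_nil _ S); rewrite big_nil leqn0 => /eqP.
Qed.

Lemma len_eq0 w : len w = 0%N -> w = 1.
Proof. by have [[|x a] [_ <- <-]] := reduced_word w; rewrite ?big_nil. Qed.

Lemma lenM u v : len (u * v) <= len u + len v.
Proof.
have [a [Sa <- <-]] := reduced_word u; have [b [Sb <- <-]] := reduced_word v.
by rewrite -size_cat -big_cat; apply: len_word; apply/word_cat.
Qed.

Lemma odd_lenM u v : odd (len (u * v)) = odd (len u) (+) odd (len v).
Proof.
have [a [Sa <- <-]] := reduced_word u; have [b [Sb <- <-]] := reduced_word v.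
by rewrite -oddD -size_cat -big_cat odd_len_word //; apply/word_cat.
Qed.

Lemma genK s : S s -> s * s = 1.
Proof. by have [m [mS pS]] := coxS; exact: (generator_sqr mS pS). Qed.

Lemma genV s : S s -> s^-1 = s.
Proof. by move=> /genK/mulg1_eq. Qed.

Lemma len_gen s : S s -> len s = 1%N.
Proof.
move=> Ss; have Sa : word_over S [:: s] by apply/word_cons; split.
have := odd_len_word Sa; have := len_word Sa; rewrite big_seq1 /=.
by case: (len s) => [|[]].
Qed.

Lemma lenV w : len w^-1 = len w.
Proof.
suff le_lenV v : len v^-1 <= len v.
  by apply/eqP; rewrite eqn_leq le_lenV -[X in len X <= _]invgK le_lenV.
have [a [Sa <- <-]] := reduced_word v; elim: a Sa => [|x a IHa].
  by rewrite big_nil invg1 len1.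
move=> /word_cons[Sx /IHa le_a]; rewrite big_cons invgM (genV Sx).
by apply: leq_trans (lenM _ _) _; rewrite (len_gen Sx) addn1 ltnS.
Qed.

Lemma refl_gen s : S s -> refl s.
Proof. by move=> Ss; exists 1 => //; exists s => //; rewrite mul1g invg1 mulg1. Qed.

Lemma refl_conj w p : refl p -> refl (w * p * w^-1).
Proof.
move=> [u _ [s Ss <-]]; exists (w * u) => //; exists s => //.
by group_simp.
Qed.

Lemma reflK p : refl p -> p * p = 1.
Proof.
by move=> [u _ [s Ss <-]]; group_simp; rewrite -(mulgA u s s) genK // mulg1 mulgV.
Qed.

Lemma reflV p : refl p -> p^-1 = p.
Proof. by move=> /reflK/mulg1_eq. Qed.

Lemma odd_len_refl p : refl p -> odd (len p).
Proof.
move=> [u _ [s Ss <-]]; rewrite !odd_lenM lenV (len_gen Ss).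
by case: (odd (len u)).
Qed.

Lemma refl_neq1 p : refl p -> p <> 1.
Proof. by move=> /odd_len_refl + E; rewrite E len1. Qed.

(** For fixed [w], the reflections [p] with this property are the right inversions of [w]. *)
Definition desc w p : bool := len (w * p) < len w.

Lemma desc1 p : desc 1 p = false.
Proof. by rewrite /desc len1. Qed.

Lemma desc_refl p : refl p -> desc p p.
Proof.
by move=> Rp; rewrite /desc reflK // len1 odd_gt0 ?odd_len_refl.
Qed.

(** Strong exchange condition. Odd parity permits a deletion in a reduced word. If the parity is
    even, appending a word for [p], in which [p] has odd parity, makes it odd, so [p] is an
    inversion of the product times [p]. *)
Lemma desc_word a p : refl p -> word_over S a ->
  inv_parity a p = desc (\prod_(x <- a) x) p.
Proof.
move=> Rp; have [m [mS pS]] := coxS.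
have lt_len b : word_over S b -> inv_parity b p -> desc (\prod_(x <- b) x) p.
  move=> Sb; have [c [Sc szc Ec]] := reduced_word (\prod_(x <- b) x).
  rewrite (inv_parity_prod mS pS p Sb Sc) ?Ec // => /(inv_parity_deletion mS pS Sc).
  case=> d [sub_dc lt_dc Ed]; rewrite /desc -szc -Ec -Ed.
  by apply: leq_ltn_trans (len_word _) lt_dc => x /(mem_subseq sub_dc)/Sc.
(* Compare with [c ++ s :: d], where [d] is a word for the inverse of [c]: the middle letter yields
   [p], and the contributions of [c] and [d] cancel because [c ++ d] represents 1. *)
have inv_self b : word_over S b -> \prod_(x <- b) x = p -> inv_parity b p.
  have [u _ [s Ss <-]] := Rp.
  have [c [Sc _ <-]] := reduced_word u.
  have [d [Sd _ Ed]] := reduced_word (\prod_(x <- c) x)^-1.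
  move=> Sb Eb; set q := _ * _ in Eb *.
  have Scsd : word_over S (c ++ s :: d) by apply/word_cat; rewrite word_cons.
  rewrite (inv_parity_prod mS pS q Sb Scsd).
    rewrite inv_parity_cat /= big_cons Ed -/q /q.
    set v := \prod_(x <- c) x; group_simp.
    rewrite eqxx /=; have := inv_parity_cat c d (v * s * v^-1).
    rewrite Ed -/v; group_simp.
    rewrite (inv_parity_prod mS pS _ (b := [::])) ?big_nil //=; last first.
    - by rewrite big_cat /= Ed mulgV.
    - by apply/word_cat.
    by case: inv_parity; case: inv_parity.
  by rewrite Eb big_cat big_cons /= Ed mulgA.
move=> Sa; apply/idP/idP; first exact: lt_len.
apply: contraTT => Na; rewrite /desc -leqNgt ltnW //.
have [b [Sb _ Eb]] := reduced_word p.
have Sab : word_over S (a ++ b) by apply/word_cat.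
have := lt_len _ Sab; rewrite /desc big_cat /= Eb -mulgA reflK // mulg1; apply.
by rewrite inv_parity_cat Eb mulgK (negPf Na) /= inv_self.
Qed.

(** The cocycle identity for inversions, read off a concatenation of words. *)
Lemma descM u v p : refl p -> desc (u * v) p = desc v p (+) desc u (v * p * v^-1).
Proof.
move=> Rp; have [a [Sa _ Ea]] := reduced_word u; have [b [Sb _ Eb]] := reduced_word v.
have Rp' := refl_conj v Rp.
have Sab : word_over S (a ++ b) by apply/word_cat.
have := desc_word Rp Sab; rewrite big_cat /= Ea Eb inv_parity_cat Eb.
by rewrite (desc_word Rp' Sa) (desc_word Rp Sb) Ea Eb addbC => ->.
Qed.

Lemma desc_gen s p : S s -> refl p -> desc s p = (p == s).
Proof.
move=> Ss Rp; have Sa : word_over S [:: s] by apply/word_cons; split.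
have := desc_word Rp Sa; rewrite /= big_nil big_seq1 invg1 mul1g mulg1 => <-.
by rewrite addbF.
Qed.

Lemma len_desc w s : S s -> desc w s -> len w = (len (w * s)).+1.
Proof.
move=> Ss; rewrite /desc => lt_ws; apply/eqP; rewrite eqn_leq lt_ws andbT.
rewrite -{1}[w](mulgK s) genV //; apply: leq_trans (lenM _ _) _.
by rewrite (len_gen Ss) addn1.
Qed.

Lemma desc_swap w p : refl p -> desc (w * p) p = ~~ desc w p.
Proof.
by move=> Rp; rewrite descM // desc_refl // mulgK.
Qed.

Lemma len_asc w s : S s -> ~~ desc w s -> len (w * s) = (len w).+1.
Proof.
move=> Ss Nws; rewrite (len_desc Ss (w := w * s)).
  by rewrite -mulgA genK // mulg1.
by rewrite desc_swap //; apply: refl_gen.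
Qed.

Lemma exists_desc w : w <> 1 -> exists2 s, S s & desc w s.
Proof.
have [a [Sa sza Ea]] := reduced_word w; case/lastP: a Sa sza Ea => [|a s].
  by rewrite big_nil => _ _ <-.
rewrite -cats1 => /word_cat[Sa /word_cons[Ss _]].
rewrite size_cat addn1 big_cat big_seq1 /= => sza Ea _; exists s => //.
by rewrite /desc -sza -Ea -mulgA genK // mulg1 ltnS len_word.
Qed.

Definition ldesc w p : bool := len (p * w) < len w.

Lemma ldescE w p : refl p -> ldesc w p = desc w^-1 p.
Proof.
by move=> Rp; rewrite /desc -[in w^-1 * p](reflV Rp) -invgM !lenV.
Qed.

Lemma len_ldesc w s : S s -> ldesc w s -> len w = (len (s * w)).+1.
Proof.
move=> Ss; rewrite ldescE; last exact: refl_gen.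
by move=> /(len_desc Ss); rewrite -[in w^-1 * s](genV Ss) -invgM !lenV.
Qed.

Lemma len_lasc w s : S s -> ~~ ldesc w s -> len (s * w) = (len w).+1.
Proof.
move=> Ss; rewrite ldescE; last exact: refl_gen.
by move=> /(len_asc Ss); rewrite -[in w^-1 * s](genV Ss) -invgM !lenV.
Qed.

Lemma desc_mull x s t : S s -> S t -> desc (t * x) s = desc x s (+) (x * s == t * x).
Proof.
move=> Ss St; have Rs := refl_gen Ss.
rewrite descM // (desc_gen St); last exact: refl_conj.
by congr (_ (+) _); apply/eqP/eqP => [<-|->]; group_simp.
Qed.

Lemma ldesc_mulr x s t : S s -> S t -> ldesc (x * t) s = ldesc x s (+) (s * x == x * t).
Proof.
move=> Ss St; have Rs := refl_gen Ss.
rewrite !ldescE // invgM (genV St) desc_mull //; congr (_ (+) _).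
by rewrite -[LHS]eqg_inv !invgM !invgK !genV.
Qed.

End Length.

(** * Bruhat order *)

Section Bruhat.
Context {W : groupType} (S : set W) (coxS : coxeter_system S).
Implicit Types (s t u v w x p q : W) (a b : seq W).
Local Notation len := (coxeter_length S).
Local Notation refl := (reflections S).
Local Notation desc := (desc S).
Local Notation ldesc := (ldesc S).
Local Notation "u <=B w" := (bruhat_le S u w) (at level 70).

Lemma bruhat_desc w p : refl p -> desc w p -> w * p <=B w.
Proof.
move=> Rp lt_wp; apply: rt_step; split=> //; exists p => //.
by rewrite -mulgA (reflK coxS Rp) mulg1.
Qed.

Lemma bruhat_asc w s : S s -> ~~ desc w s -> w <=B w * s.
Proof.
move=> Ss Nws; apply: rt_step; split; last by rewrite len_asc.
by exists s => //; apply: refl_gen.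
Qed.

Lemma bruhat_leV u w : u <=B w -> u^-1 <=B w^-1.
Proof.
elim=> {u w} [u w [[t Rt ->] lt_uw]|u|u v w _ uv _ vw].
- apply: rt_step; split; last by rewrite !lenV.
  exists (u * t * u^-1); first exact: refl_conj.
  by rewrite invgM (reflV coxS Rt) !mulgA mulVg mul1g.
- exact: rt_refl.
- exact: rt_trans vw.
Qed.

(** For [t <> s] the conjugate [s^-1 * t * s] is not an inversion of [s], so by the cocycle identity
    it is one of [w * s], just as [t] is one of [w]. *)
Lemma bruhat_step_mulr u w s : S s -> bruhat_step S u w ->
  u * s = w \/ bruhat_step S (u * s) (w * s).
Proof.
move=> Ss [[t Rt ->] lt_u]; case: (eqVneq t s) => [->|ts]; [by left|right].
have Rs := refl_gen Ss; have Rq : refl (s^-1 * t * s).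
  by rewrite -[s in _ * s]invgK; apply: refl_conj.
split; first by exists (s^-1 * t * s) => //; group_simp.
have -> : u * s = u * t * s * (s^-1 * t * s).
  by group_simp; rewrite -(mulgA u) (reflK coxS Rt) mulg1.
rewrite -[_ < _]/(desc _ _) (descM coxS) // desc_gen //.
have -> : s^-1 * t * s == s = (t == s).
  apply/eqP/eqP => [E|->]; last by group_simp.
  by have := congr1 (fun x => s * x * s^-1) E; group_simp.
by rewrite (negPf ts); group_simp; rewrite /desc -mulgA (reflK coxS Rt) mulg1.
Qed.

(** The lifting property, in a form that can be composed along chains. *)
Lemma bruhat_le_mulr u w s : S s -> u <=B w ->
  u * s <=B w * s \/ (u * s <=B w /\ u <=B w * s).
Proof.
move=> Ss; elim=> {u w} [u w /(bruhat_step_mulr Ss)[<-|]|u|u v w uv IHuv vw IHvw].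
- by right; rewrite -mulgA (genK coxS) // mulg1; split; apply: rt_refl.
- by left; apply: rt_step.
- by left; apply: rt_refl.
case: IHuv => [usvs|[usv uvs]]; case: IHvw => [vsws|[vsw vws]].
- by left; apply: rt_trans vsws.
- by right; split; [apply: rt_trans vsw|apply: rt_trans vws].
- by right; split; [apply: rt_trans vw|apply: rt_trans vsws].
- by right; split; [apply: rt_trans vw|apply: rt_trans vws].
Qed.

Lemma bruhat_mulr2 u w s : S s -> u <=B w -> desc u s || ~~ desc w s ->
  u * s <=B w * s.
Proof.
move=> Ss uw; have [//|[usw uws]] := bruhat_le_mulr Ss uw.
case/orP=> [ds|ds]; first by apply: rt_trans uws; apply/bruhat_desc/ds/refl_gen.
by apply: rt_trans usw _; apply: bruhat_asc.
Qed.

Lemma bruhat_mulr_asc u w s : S s -> u <=B w -> ~~ desc u s -> u <=B w * s.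
Proof.
move=> Ss uw ds; have [usws|[]//] := bruhat_le_mulr Ss uw.
by apply: rt_trans usws; apply: bruhat_asc.
Qed.

Lemma bruhat_mulr_desc u w s : S s -> u <=B w -> desc w s -> u * s <=B w.
Proof.
move=> Ss uw ds; have [usws|[]//] := bruhat_le_mulr Ss uw.
by apply: rt_trans usws _; apply/bruhat_desc/ds/refl_gen.
Qed.

Lemma bruhat_mull2 u w s : S s -> u <=B w -> ldesc u s || ~~ ldesc w s ->
  s * u <=B s * w.
Proof.
move=> Ss /bruhat_leV uw; rewrite !(ldescE coxS _ (refl_gen Ss)) => ds.
by have /bruhat_leV := bruhat_mulr2 Ss uw ds; rewrite !invgM !invgK (genV coxS).
Qed.

Lemma bruhat_mull_asc u w s : S s -> u <=B w -> ~~ ldesc u s -> u <=B s * w.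
Proof.
move=> Ss /bruhat_leV uw; rewrite (ldescE coxS _ (refl_gen Ss)) => ds.
by have /bruhat_leV := bruhat_mulr_asc Ss uw ds; rewrite !invgM !invgK (genV coxS).
Qed.

Lemma bruhat_mull_desc u w s : S s -> u <=B w -> ldesc w s -> s * u <=B w.
Proof.
move=> Ss /bruhat_leV uw; rewrite (ldescE coxS _ (refl_gen Ss)) => ds.
by have /bruhat_leV := bruhat_mulr_desc Ss uw ds; rewrite !invgM !invgK (genV coxS).
Qed.

(** Each Bruhat step downwards deletes letters. This bounds the ideal below [w] by the finitely many
    subwords of one word. *)
Lemma bruhat_subword u w a : word_over S a -> \prod_(x <- a) x = w -> u <=B w ->
  exists2 b, subseq b a & \prod_(x <- b) x = u.
Proof.
move=> + + uw; elim: uw a => {u w} [u _ [[t Rt ->] lt_u]|u|u v w _ IHuv _ IHvw] a Sa Ea.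
- have: inv_parity a t.
    by rewrite (desc_word coxS) // Ea /desc -mulgA (reflK coxS Rt) mulg1.
  have [m [mS pS]] := coxS; case/(inv_parity_deletion mS pS Sa) => b [ba _ Eb].
  by exists b => //; rewrite Eb Ea -mulgA (reflK coxS Rt) mulg1.
- by exists a.
- have [b ba Eb] := IHvw a Sa Ea.
  have [|c cb Ec] := IHuv b _ Eb; first by move=> x /(mem_subseq ba)/Sa.
  by exists c => //; apply: subseq_trans ba.
Qed.

Lemma finite_bruhat_interval w : finite_set [set u | u <=B w].
Proof.
have [a [Sa _ Ea]] := reduced_word coxS w.
pose prod_mask (k : (size a).-tuple bool) := \prod_(x <- mask k a) x.
apply: (@sub_finite_set _ _ (range prod_mask)); last exact: finite_image.
move=> u /(bruhat_subword Sa Ea)[b /subseqP[k /eqP szk ->] <-].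
by exists (Tuple szk).
Qed.

End Bruhat.

(** * Parabolic subgroups *)

Section Parabolic.
Context {W : groupType} (S : set W) (coxS : coxeter_system S).
Context (J : set W) (JS : J `<=` S).
Implicit Types (s t u v w x p q g b : W).
Local Notation len := (coxeter_length S).
Local Notation refl := (reflections S).
Local Notation desc := (desc S).
Local Notation ldesc := (ldesc S).

Definition parabolic : set W :=
  [set w | exists2 a, word_over J a & \prod_(x <- a) x = w].

Lemma parabolic1 : parabolic 1.
Proof. by exists [::]; rewrite ?big_nil. Qed.

Lemma parabolicM u v : parabolic u -> parabolic v -> parabolic (u * v).
Proof.
move=> [a Ja <-] [b Jb <-]; exists (a ++ b); first exact/word_cat.
by rewrite big_cat.
Qed.

Lemma parabolic_gen s : J s -> parabolic s.
Proof. by move=> Js; exists [:: s]; rewrite ?big_seq1 ?word_cons. Qed.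

Lemma parabolic_ind (P : W -> Prop) : P 1 ->
  (forall g s, parabolic g -> J s -> P g -> P (g * s)) ->
  forall g, parabolic g -> P g.
Proof.
move=> P1 PM _ [a + <-]; elim/last_ind: a => [|a s IHa]; first by rewrite big_nil.
rewrite -cats1 big_cat big_seq1 => /word_cat[Ja /word_cons[Js _]].
by apply: PM => //; [exists a|apply: IHa].
Qed.

Lemma parabolicV u : parabolic u -> parabolic u^-1.
Proof.
elim/parabolic_ind=> {u} [|u s _ Js IHu]; first by rewrite invg1; apply: parabolic1.
rewrite invgM (genV coxS (JS Js)); apply: parabolicM IHu.
exact: parabolic_gen.
Qed.

Lemma parabolic_conj u v : parabolic u -> parabolic v -> parabolic (u * v * u^-1).
Proof.
by move=> Pu Pv; apply: parabolicM; [apply: parabolicM|apply: parabolicV].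
Qed.

(** If the last letter of a word over [J] is not a descent of [g], the rest of the word absorbs it
    by a deletion, leaving a shorter word over [J]. *)
Lemma parabolic_desc g : parabolic g -> g <> 1 -> exists2 s, J s & desc g s.
Proof.
move=> [a Ja Ea]; have [n le_an] := ubnP (size a).
elim: n a Ja Ea le_an => // n IHn a; case/lastP: a => [|a s].
  by rewrite big_nil => _ <-.
rewrite -cats1 => /[dup] Jas /word_cat[Ja /word_cons[Js _]] Eas.
rewrite size_cat addn1 ltnS => le_an g1.
have toS (b : seq W) : word_over J b -> word_over S b by move=> Jb x /Jb/JS.
have [m [mS pS]] := coxS; have Rs := refl_gen (JS Js).
case inv_as: (inv_parity a s); last first.
  exists s => //; rewrite -Eas -(desc_word coxS Rs (toS _ Jas)).
  by rewrite inv_parity_cat /= !big_nil big_seq1 invg1 mul1g mulg1 eqxx mulgK inv_as.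
have [b [ba lt_ba Eb]] := inv_parity_deletion mS pS (toS _ Ja) inv_as.
apply: (IHn b) => //; last exact: ltn_trans le_an.
  by move=> x /(mem_subseq ba)/Ja.
by rewrite Eb -Eas big_cat big_seq1.
Qed.

Lemma parabolic_inversion g p : parabolic g -> refl p -> desc g p -> parabolic p.
Proof.
move=> Pg; have [a Ja Ea] := Pg; have [m [mS pS]] := coxS => Rp.
have Sa : word_over S a by move=> x /Ja/JS.
rewrite -{1}Ea -desc_word // => /(inv_parity_deletion mS pS Sa)[b [ba _ Eb]].
rewrite -(mulKg g p) -Ea -Eb; apply: parabolicM; first by rewrite Ea; apply: parabolicV.
by exists b => // x /(mem_subseq ba)/Ja.
Qed.

Definition coset_min b : Prop := forall s, J s -> ~~ desc b s.

Lemma coset_min_decomposition w : exists b g,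
  [/\ w = b * g, parabolic g &
      forall p, refl p -> parabolic p -> ~~ desc b p].
Proof.
have [n le_wn] := ubnP (len w); elim: n w le_wn => // n IHn w le_wn.
have [minw|/existsNP[p /not_implyP[Rp /not_implyP[Pp /negP/negPn dwp]]]] :=
  pselect (forall p, refl p -> parabolic p -> ~~ desc w p).
  by exists w, 1; split=> //; [rewrite mulg1|apply: parabolic1].
have [|b [g [E Pg minb]]] := IHn (w * p); first exact: leq_trans dwp le_wn.
exists b, (g * p); split=> //; last exact: parabolicM.
by rewrite mulgA -E -mulgA (reflK coxS Rp) mulg1.
Qed.

(** In [b = b0 * g] with [b0] free of parabolic inversions, a descent of [g] in [J] would be one of
    [b], so [g = 1]. *)
Lemma coset_min_desc b p : coset_min b -> refl p -> parabolic p -> ~~ desc b p.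
Proof.
have [b0 [g [-> Pg minb0]]] := coset_min_decomposition b => minb.
suff -> : g = 1 by rewrite mulg1; apply: minb0.
apply: contrapT => /(parabolic_desc Pg)[s Js dgs].
have Rs := refl_gen (JS Js).
have := minb s Js; rewrite descM // dgs /= negbK; apply/negP.
apply: minb0; first exact: refl_conj.
by apply: parabolic_conj => //; apply: parabolic_gen.
Qed.

Lemma coset_min_descM b g s : coset_min b -> parabolic g -> J s ->
  desc (b * g) s = desc g s.
Proof.
move=> minb Pg Js; have Rs := refl_gen (JS Js).
rewrite descM // (negPf (coset_min_desc minb _ _)) ?addbF //.
  exact: refl_conj.
by apply: parabolic_conj => //; apply: parabolic_gen.
Qed.

Lemma coset_min_len b g : coset_min b -> parabolic g ->
  len (b * g) = (len b + len g)%N.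
Proof.
move=> minb; elim/parabolic_ind=> {g} [|g s Pg Js IHg].
  by rewrite mulg1 len1 addn0.
have Ss := JS Js; have := coset_min_descM minb Pg Js; rewrite mulgA.
case dgs: (desc g s) => dbgs.
  have := len_desc coxS Ss dgs; have := len_desc coxS Ss dbgs.
  by rewrite IHg => + E; rewrite E addnS => -[].
by rewrite !(len_asc coxS Ss) ?dgs ?dbgs // IHg addnS.
Qed.

(** Deodhar's lemma. If [t * b] were minimal too, lengths would add and [t] would lengthen [b * g].
    So [t * b] has a descent [s] in [J] that [b] lacks, which forces [t * b = b * s]. *)
Lemma coset_min_mull b g t : coset_min b -> parabolic g -> S t ->
  ldesc (b * g) t -> ~~ ldesc b t -> exists2 s, J s & t * b = b * s.
Proof.
move=> minb Pg St dbgt Ndbt.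
have [mintb|/existsNP[s /not_implyP[Js /negP/negPn dtbs]]] :=
  pselect (coset_min (t * b)).
  have := dbgt; rewrite /ldesc mulgA coset_min_len // coset_min_len //.
  by rewrite len_lasc // addSn ltnNge leqnSn.
exists s => //; have := dtbs; rewrite desc_mull //; last exact: JS.
by rewrite (negPf (minb s Js)) /= => /eqP.
Qed.

(** Every [g] of the parabolic subgroup splits off [w] on the right. For [g = h * s] with [h]
    shorter, the cocycle identity makes [h * s * h^-1] an inversion of [w * h^-1], and multiplying
    by it gives [w * g^-1]. *)
Lemma longest_len w g : (forall s, J s -> desc w s) -> parabolic g ->
  (len (w * g^-1) + len g)%N = len w.
Proof.
move=> longw; have [n le_gn] := ubnP (len g).
elim: n g le_gn => // n IHn g le_gn Pg.
have [->|/eqP g1] := eqVneq g 1; first by rewrite invg1 mulg1 len1 addn0.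
have [s Js dgs] := parabolic_desc Pg g1; have Ss := JS Js; have Rs := refl_gen Ss.
have Eg := len_desc coxS Ss dgs; set h := g * s in Eg.
have Ph : parabolic h by apply: parabolicM => //; apply: parabolic_gen.
have IHh := IHn h (leq_trans dgs le_gn) Ph.
have := descM coxS (w * h^-1) h Rs; rewrite mulgVK longw //.
rewrite desc_swap // dgs /= /desc.
have -> : w * h^-1 * (h * s * h^-1) = w * g^-1.
  rewrite -(mulgA w) -(mulgA h) mulKg /h invgM (genV coxS Ss) (mulgA s).
  by rewrite (genK coxS) // mul1g.
move=> /esym lt_wg; apply/eqP; rewrite eqn_leq; apply/andP; split.
  by rewrite -IHh Eg addnS -addSn leq_add2r.
by rewrite -{1}[w](mulgVK g) lenM.
Qed.

Lemma longest_sqr w : (forall s, J s -> desc w s) -> parabolic w -> w * w = 1.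
Proof.
move=> longw Pw; have := longest_len longw (parabolicV Pw).
rewrite invgK lenV // -[RHS]add0n => /eqP; rewrite eqn_add2r => /eqP.
exact: len_eq0.
Qed.

Lemma longest_unique w v : (forall s, J s -> desc w s) -> parabolic v ->
  len v = len w -> v = w.
Proof.
move=> longw Pv Evw; have := longest_len longw Pv.
rewrite Evw -[RHS]add0n => /eqP; rewrite eqn_add2r => /eqP /(len_eq0 coxS)/divg1_eq.
by [].
Qed.

Lemma longest_conj w s : (forall s, J s -> desc w s) -> parabolic w -> J s ->
  J (w * s * w).
Proof.
move=> longw Pw Js; have ww := longest_sqr longw Pw.
have Ss := JS Js; have Pws := parabolicM Pw (parabolic_gen Js).
have Ew : w^-1 = w by apply: mulg1_eq.
have len1' : len (w * s * w) = 1%N.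
  have := longest_len longw Pws; rewrite invgM Ew (genV coxS Ss) mulgA.
  by rewrite (len_desc coxS Ss (longw s Js)) -add1n => /eqP; rewrite eqn_add2r => /eqP.
have Pwsw := parabolicM Pws Pw.
have [|c Jc] := parabolic_desc Pwsw; first by move=> E; rewrite E len1 in len1'.
rewrite /desc len1' ltnS leqn0 => /eqP/(len_eq0 coxS)/mulg1_eq E.
by rewrite -[w * s * w]invgK E (genV coxS (JS Jc)).
Qed.

End Parabolic.

(** * Reflections normalizing a parabolic subgroup *)

Section ReflectionsNormalizingParabolics.
Context {W : groupType} (S : set W) (coxS : coxeter_system S).
Context (J : set W) (JS : J `<=` S).
Implicit Types (s t u v w x y z p q g b : W).
Local Notation len := (coxeter_length S).
Local Notation refl := (reflections S).
Local Notation desc := (desc S).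
Local Notation parabolic := (parabolic J).

(* Geometrically, the root of c is orthogonal to the simple root of s: it cannot
   be proportional to the difference of two simple roots, and for c outside of
   the parabolic subgroup it cannot be proportional to their sum.  The proof
   shows that c is its own only inversion in the coset c * parabolic. *)
Lemma refl_normalizer c s : refl c -> (forall t, J t -> J (c * t * c)) ->
  ~ parabolic c -> J s -> s * c * s = c.
Proof.
move=> Rc normJ Nc Js; have cK := reflK coxS Rc; have cV := reflV coxS Rc.
have Ss := JS Js; have Rs := refl_gen Ss; have sV := genV coxS Ss.
have norm g : parabolic g -> parabolic (c * g * c).
  elim/(parabolic_ind (J := J))=> {g} [|g t _ Jt IHg].
    by rewrite mulg1 cK; apply: parabolic1.
  have -> : c * (g * t) * c = c * g * c * (c * t * c).
    by rewrite !mulgA -(mulgA (c * g) c c) cK mulg1.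
  by apply/(parabolicM IHg)/parabolic_gen/normJ.
(* As [c] is an involution normalizing the parabolic subgroup, this is both its left and its right
   coset. *)
pose out y := parabolic (c * y).
have outc : out c by rewrite /out cK; apply: parabolic1.
have Nout y : out y -> ~ parabolic y.
  move=> oy Py; apply: Nc; rewrite -[c](mulgK y).
  exact/(parabolicM oy)/(parabolicV coxS JS).
have out_mull g y : parabolic g -> out y -> out (g * y).
  move=> Pg oy; rewrite /out.
  have -> : c * (g * y) = c * g * c * (c * y).
    by rewrite !mulgA -(mulgA (c * g) c c) cK mulg1.
  exact: parabolicM (norm _ Pg) oy.
have out_mulr g y : parabolic g -> out y -> out (y * g).
  by move=> Pg oy; rewrite /out mulgA; apply: parabolicM.
have out_conj x y : out x -> out y -> out (x * y * x).
  move=> ox oy; rewrite /out.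
  have -> : c * (x * y * x) = c * x * (c * (c * y) * c) * (c * x).
    by rewrite !mulgA -(mulgA _ c c) cK mulg1 -(mulgA _ c c) cK mulg1.
  exact: (parabolicM (parabolicM ox (norm _ oy)) ox).
(* At the first inversion in the coset met along a word, conjugation exhibits
   a reflection q that is its own only inversion in the coset. *)
have first_out a : word_over S a ->
    (exists y, [/\ refl y, out y & desc (\prod_(x <- a) x) y]) ->
  exists v t, [/\ S t, out (v^-1 * t * v) & forall y, refl y -> out y -> ~~ desc v y].
  elim: a => [_ [y []]|t a IHa]; first by rewrite big_nil desc1.
  move=> /word_cons[St Sa]; rewrite big_cons; set v := \prod_(x <- a) x.
  have [exy _|Nexy [y [Ry oy]]] :=
    pselect (exists y, [/\ refl y, out y & desc v y]); first exact: IHa.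
  have Nv z : refl z -> out z -> ~~ desc v z.
    by move=> Rz oz; apply/negP => dvz; apply: Nexy; exists z.
  have Rvy := refl_conj v Ry.
  rewrite (descM coxS t v Ry) (negPf (Nv y Ry oy)) (desc_gen coxS St Rvy) => /eqP Et.
  by exists v, t; split=> //; rewrite -Et; group_simp.
have [a [Sa _ Ea]] := reduced_word coxS c.
have [|v [t [St oq Nv]]] := first_out a Sa.
  by exists c; split=> //; rewrite Ea desc_refl.
set q := v^-1 * t * v in oq.
have Rq : refl q by rewrite /q -{2}[v]invgK; apply/refl_conj/refl_gen.
have qV := reflV coxS Rq.
(* Expand both sides of [v * q = t * v] by the cocycle identity; [v] has no inversion in the
   coset. *)
have descq y : refl y -> out y -> desc q y = (y == q).
  move=> Ry oy; have Evq : v * q = t * v by rewrite /q; group_simp.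
  have Rqy := refl_conj q Ry; have Rvy := refl_conj v Ry.
  have := descM coxS v q Ry; rewrite Evq (descM coxS t v Ry) (desc_gen coxS St Rvy).
  rewrite (negPf (Nv _ Ry oy)) (negPf (Nv _ Rqy _)); last first.
    by rewrite qV; apply: out_conj.
  rewrite addbF /= => <-; apply/eqP/eqP => [E|->]; last by rewrite /q; group_simp.
  by rewrite /q -E; group_simp.
have Pqc : parabolic (q * c).
  by rewrite -[q * c]invgK invgM qV cV; exact: (parabolicV coxS JS oq).
(* Since [q * c] is parabolic, [y] is not an inversion of it; so if [y] is one of [c], then
   [c * y * c] is one of [q]. *)
have only y : refl y -> out y -> desc c y -> c * y * c = q.
  move=> Ry oy dcy; have Rcy := refl_conj c Ry.
  have := descM coxS q c Ry; rewrite dcy cV in Rcy *.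
  rewrite descq //; last exact: out_conj.
  case: eqP => // _ /= dqc; case: (Nout y oy).
  exact: parabolic_inversion dqc.
have Eq : c = q by rewrite -(only c Rc outc (desc_refl coxS Rc)) cK mul1g.
have Rscs : refl (s * c * s) by rewrite -{2}sV; apply: refl_conj.
have oscs : out (s * c * s).
  by apply: out_mulr; [|apply: out_mull => //]; apply: parabolic_gen.
have St' := JS (normJ s Js); have Rt' := refl_gen St'.
have Nct g : J g -> c == g = false.
  by move=> Jg; apply/eqP => Ec; apply: Nc; rewrite Ec; apply: parabolic_gen.
have Ecs : c * s * c * c = c * s by rewrite -(mulgA _ c c) cK mulg1.
(* Test the inversion [c] on [c * s = (c * s * c) * c] in both factorizations; [s] and [c * s * c]
   are simple and differ from [c]. *)
have dscs : desc c (s * c * s).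
  have := descM coxS (c * s * c) c Rc; rewrite Ecs (descM coxS c s Rc).
  rewrite mulgK sV (desc_gen coxS Ss Rc) (desc_gen coxS St' Rc).
  by rewrite !Nct ?desc_refl //; apply: normJ.
have := only _ Rscs oscs dscs; rewrite -Eq => /(congr1 (fun x => c * x * c)).
by rewrite cK mul1g !mulgA cK mul1g -(mulgA _ c c) cK mulg1.
Qed.

End ReflectionsNormalizingParabolics.

(** * Twisted identities *)

Section TwistedIdentities.
Context {W : groupType} (S : set W) (coxS : coxeter_system S).
Context (th : W -> W) (autth : involutive_automorphism S th).
Implicit Types (s t u v w x y z p q g b r c : W).
Local Notation len := (coxeter_length S).
Local Notation refl := (reflections S).
Local Notation desc := (desc S).
Local Notation ldesc := (ldesc S).
Local Notation io := (twisted_identities th).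
Local Notation "u <=B w" := (bruhat_le S u w) (at level 70).

Lemma autM x y : th (x * y) = th x * th y.
Proof. by have [thM _ _] := autth; apply: thM. Qed.

Lemma autK : involutive th.
Proof. by have [_ _] := autth. Qed.

Lemma aut1 : th 1 = 1.
Proof. by apply: (mulgI (th 1)); rewrite -autM !mulg1. Qed.

Lemma autV x : th x^-1 = (th x)^-1.
Proof. by symmetry; apply: mulg1_eq; rewrite -autM mulgV aut1. Qed.

Lemma aut_gen s : S s -> S (th s).
Proof. by have [_ thS _] := autth; move=> Ss; rewrite -thS; exists s. Qed.

Lemma aut_len w : len (th w) = len w.
Proof.
suff le_len v : len (th v) <= len v.
  by apply/eqP; rewrite eqn_leq le_len -{1}[w]autK le_len.
have [a [Sa <- <-]] := reduced_word coxS v.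
have -> : th (\prod_(x <- a) x) = \prod_(x <- map th a) x.
  elim: (a) => [|x b IHb]; first by rewrite !big_nil aut1.
  by rewrite /= !big_cons autM IHb.
rewrite -(size_map th); apply: len_word => _ /mapP[x ax ->].
exact/aut_gen/Sa.
Qed.

Lemma aut_desc w p : desc (th w) (th p) = desc w p.
Proof. by rewrite /desc -autM !aut_len. Qed.

(* Where s fixes the root of u^-1 * s * u up to the twist, the signs that u
   contributes on both sides cancel. *)
Lemma desc_twisted_conj u r s : S s -> th s * (th u * r * u^-1) = th u * r * u^-1 * s ->
  desc (th u * r * u^-1) s = desc r (u^-1 * s * u).
Proof.
move=> Ss E; have Rs := refl_gen Ss; set p := u^-1 * s * u.
have Rp : refl p by rewrite /p -{2}[u]invgK; apply: refl_conj.
have thp : r * p * r^-1 = th p.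
  have := congr1 (fun x => (th u)^-1 * x * u * r^-1) E; rewrite /p !autM autV.
  by group_simp => <-.
have us : u^-1 * s * u^-1^-1 = p by rewrite invgK.
rewrite (descM coxS _ _ Rs) us (descM coxS _ _ Rp) thp aut_desc.
have := descM coxS u u^-1 Rs; rewrite mulgV desc1 us.
by case: (desc u^-1 s); case: (desc u p); case: (desc r p).
Qed.

(** The case [r = 1] of [desc_twisted_conj], as 1 has no inversion. It keeps the matching from
    fixing elements with descent [s]. *)
Lemma twisted_fixed_asc y s : io y -> S s -> th s * y = y * s -> ~~ desc y s.
Proof.
move=> [u _ <-] Ss E; have := @desc_twisted_conj u 1 s Ss.
by rewrite mulg1 => /(_ E) ->; rewrite desc1.
Qed.

Lemma fixed_desc_unique u r s : S r -> S s ->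
  th s * (th u * r * u^-1) = th u * r * u^-1 * s -> desc (th u * r * u^-1) s ->
  s = u * r * u^-1.
Proof.
move=> Sr Ss E; rewrite desc_twisted_conj // desc_gen //.
  by move=> /eqP <-; group_simp.
by rewrite -{2}[u]invgK; apply/refl_conj/refl_gen.
Qed.

(** Twisted conjugation, applied to generators [c], which are their own inverses. *)
Definition tconj c x := th c * x * c.

Lemma tconjK c : S c -> involutive (tconj c).
Proof.
move=> Sc x; rewrite /tconj !mulgA -autM (genK coxS Sc) aut1 mul1g.
by rewrite -mulgA (genK coxS Sc) mulg1.
Qed.

Lemma twisted_tconj c x : S c -> io x -> io (tconj c x).
Proof.
move=> Sc [u _ <-]; exists (c * u) => //.
by rewrite autM invgM (genV coxS Sc) /tconj !mulgA.
Qed.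

Lemma twisted_inv x : io x -> th x = x^-1.
Proof. by move=> [u _ <-]; rewrite autM autV autK invgM invgK. Qed.

Lemma twisted_even x : io x -> ~~ odd (len x).
Proof. by move=> [u _ <-]; rewrite odd_lenM // lenV // aut_len addbb. Qed.

Lemma twisted_ldesc x s : io x -> S s -> ldesc x (th s) = desc x s.
Proof.
move=> iox Ss; rewrite (ldescE coxS _ (refl_gen (aut_gen Ss))).
by rewrite -twisted_inv // aut_desc.
Qed.

Lemma twisted_ldesc_mul x s : io x -> S s ->
  ldesc (x * s) (th s) = desc x s (+) (th s * x == x * s).
Proof.
move=> iox Ss; rewrite ldesc_mulr //; last exact: aut_gen.
by rewrite twisted_ldesc.
Qed.

Lemma twisted_ldesc_desc x s : io x -> S s -> desc x s -> ldesc (x * s) (th s).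
Proof.
move=> iox Ss dxs; rewrite twisted_ldesc_mul // dxs.
by case: eqP => // /(twisted_fixed_asc iox Ss); rewrite dxs.
Qed.

Lemma twisted_lasc_mull x s : io x -> S s -> desc x s -> ~~ ldesc (tconj s x * s) (th s).
Proof.
move=> iox Ss dxs; have Sts := aut_gen Ss; rewrite /tconj -mulgA (genK coxS Ss) mulg1.
rewrite /ldesc mulgA (genK coxS Sts) mul1g -leqNgt ltnW //.
by rewrite -[_ < _]/(ldesc _ _) twisted_ldesc.
Qed.

Lemma len_tconj_desc x s : io x -> S s -> desc x s -> len x = (len (tconj s x)).+2.
Proof.
move=> iox Ss dxs; rewrite (len_desc coxS Ss dxs); congr _.+1.
rewrite (len_ldesc coxS (aut_gen Ss)) ?twisted_ldesc_desc //.
by rewrite /tconj mulgA.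
Qed.

Lemma tconj_desc_asc x s : io x -> S s -> desc x s -> ~~ desc (tconj s x) s.
Proof.
move=> iox Ss dxs; rewrite -twisted_ldesc //; last exact: twisted_tconj.
have Sts := aut_gen Ss.
rewrite /ldesc /tconj !mulgA (genK coxS Sts) mul1g -leqNgt -mulgA ltnW //.
exact: twisted_ldesc_desc.
Qed.

Lemma bruhat_tconj_desc x s : io x -> S s -> desc x s -> tconj s x <=B x.
Proof.
move=> iox Ss dxs; rewrite /tconj -mulgA; have Sts := aut_gen Ss.
apply: (@rt_trans _ _ _ (x * s)); last by apply/bruhat_desc/dxs/refl_gen.
apply: bruhat_mull_desc => //; first exact: rt_refl.
exact: twisted_ldesc_desc.
Qed.

Lemma bruhat_tconj2 z y s : io y -> S s -> desc y s ->
  z <=B tconj s y -> tconj s z <=B y.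
Proof.
move=> ioy Ss dys zy; have Sts := aut_gen Ss.
have Ey : y = th s * (tconj s y * s) by rewrite mulgA -/(tconj s _) tconjK.
rewrite [X in _ <=B X]Ey {1}/tconj -mulgA.
apply: bruhat_mull2 => //; last by rewrite twisted_lasc_mull ?orbT.
by apply: bruhat_mulr2 => //; rewrite tconj_desc_asc ?orbT.
Qed.

Lemma bruhat_tconj2_desc z x s : io z -> S s -> desc z s ->
  z <=B x -> tconj s z <=B tconj s x.
Proof.
move=> ioz Ss dzs zx; have Sts := aut_gen Ss; rewrite /tconj -!(mulgA (th s)).
apply: bruhat_mull2 => //; last by rewrite twisted_ldesc_desc.
by apply: bruhat_mulr2 => //; rewrite dzs.
Qed.

Lemma bruhat_tconj_asc z x s : io z -> S s -> ~~ desc z s ->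
  z <=B x -> z <=B tconj s x.
Proof.
move=> ioz Ss dzs zx; have Sts := aut_gen Ss; rewrite /tconj -mulgA.
apply: bruhat_mull_asc => //; last by rewrite twisted_ldesc.
exact: bruhat_mulr_asc.
Qed.

(** Restricted to twisted identities because it is used for elements such as [x = y * s] with [s] an
    ascent of [y], which are not below [y]. *)
Definition twisted_below x y : Prop := forall z, io z -> z <=B x -> z <=B y.

(** Lift a twisted identity [z] below [x]: if [s] is a descent of [z], then [tconj s z] is below
    [tconj s x]; otherwise [z] itself is. *)
Lemma twisted_below_tconj x y s : io y -> S s -> desc y s ->
  twisted_below (tconj s x) (tconj s y) -> twisted_below x y.
Proof.
move=> ioy Ss dys below z ioz zx; case dzs: (desc z s).
  rewrite -[z](tconjK Ss); apply: bruhat_tconj2 => //.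
  by apply: below; [apply: twisted_tconj|apply: bruhat_tconj2_desc].
apply: rt_trans (bruhat_tconj_desc ioy Ss dys); apply: below => //.
by apply: bruhat_tconj_asc => //; rewrite dzs.
Qed.

(** Descend [y] by twisted conjugation with generators in [J] while possible; [h] records the
    conjugations, and the last clause carries comparisons back up. *)
Lemma twisted_coset_min (J : set W) (JS : J `<=` S) y : io y ->
  exists h b, [/\ parabolic J h, io b /\ coset_min S J b,
    y = th h * b * h^-1, b = y \/ len b < len y &
    forall x, twisted_below (th h^-1 * x * h) b -> twisted_below x y].
Proof.
have [n le_yn] := ubnP (len y); elim: n y le_yn => // n IHn y le_yn ioy.
have [miny|/existsNP[a /not_implyP[Ja /negP/negPn dya]]] := pselect (coset_min S J y).
  exists 1, y; split=> //; rewrite ?invg1 ?aut1 ?mul1g ?mulg1 //.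
  - exact: parabolic1.
  - by left.
  by move=> x; rewrite mul1g mulg1.
have Sa := JS a Ja; have ioy' := twisted_tconj Sa ioy.
have lt_y : len (tconj a y) < len y.
  by rewrite (len_tconj_desc ioy Sa dya) ltnS leqnSn.
have [|h [b [Ph iob Ey le_by below]]] := IHn (tconj a y) _ ioy'.
  exact: leq_trans lt_y le_yn.
exists (a * h), b; split=> //.
- by apply: parabolicM => //; apply: parabolic_gen.
- by rewrite -[y](tconjK Sa) Ey /tconj autM invgM (genV coxS Sa) !mulgA.
- by right; case: le_by => [->|/ltn_trans->].
move=> x; rewrite invgM autM (genV coxS Sa) => belowx.
apply: (twisted_below_tconj ioy Sa dya); apply: below.
by rewrite /tconj !mulgA in belowx *.
Qed.

End TwistedIdentities.

(** * Dihedral subgroups *)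

Section Dihedral.
Context {W : groupType} (S : set W) (coxS : coxeter_system S).
Implicit Types (s t u v w x y z p q g b r c : W).
Local Notation len := (coxeter_length S).
Local Notation refl := (reflections S).
Local Notation desc := (desc S).

Lemma refl_commuting_desc c s : refl c -> S s -> desc c s -> s * c = c * s -> c = s.
Proof.
move=> [u _ [r Sr <-]] Ss dcs E.
have aut_id : involutive_automorphism S (@idfun W).
  by split=> //; rewrite image_id.
by have /esym := fixed_desc_unique coxS aut_id Sr Ss E dcs.
Qed.

Lemma parabolic2_words s t g : S s -> S t -> parabolic [set s; t] g -> exists k,
  [\/ g = (s * t) ^+ k, g = (t * s) ^+ k,
      g = (s * t) ^+ k * s | g = (t * s) ^+ k * t].
Proof.
move=> Ss St; have ss := genK coxS Ss; have tt := genK coxS St.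
elim/(parabolic_ind (J := [set s; t])) => {g} [|g x _ [] -> [[|k] []] ->].
- by exists 0%N; constructor 1.
- by exists 0%N; constructor 3.
- by exists 0%N; constructor 3.
- by exists 0%N; constructor 1; rewrite mul1g.
- by exists 1%N; constructor 2; rewrite mul1g.
- by exists k.+1; constructor 3.
- by exists k; constructor 4; rewrite expgSr mulgA -(mulgA _ s) ss mulg1.
- by exists k.+1; constructor 1; rewrite -mulgA ss mulg1.
- by exists k.+2; constructor 2; rewrite [RHS]expgSr mulgA.
- by exists 0%N; constructor 4.
- by exists 0%N; constructor 4.
- by exists 1%N; constructor 1; rewrite mul1g.
- by exists 0%N; constructor 1; rewrite mul1g.
- by exists k; constructor 3; rewrite expgSr mulgA -(mulgA _ t) tt mulg1.
- by exists k.+1; constructor 4.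
- by exists k.+2; constructor 1; rewrite [RHS]expgSr mulgA.
- by exists k.+1; constructor 2; rewrite -mulgA tt mulg1.
Qed.

(** Having odd length, [c] is an alternating word such as [(s * t) ^+ k * s]; then
    [(s * t) ^+ k.*2.+1 = c * s * c * t = 1]. *)
Lemma odd_dihedral s t c : S s -> S t -> refl c -> parabolic [set s; t] c ->
  c * s * c = t -> exists k, (s * t) ^+ k.*2.+1 = 1.
Proof.
move=> Ss St Rc /(parabolic2_words Ss St)[k words] csc.
have cK := reflK coxS Rc; have ss := genK coxS Ss; have tt := genK coxS St.
have even_st x y : S x -> S y -> c <> (x * y) ^+ k.
  move=> Sx Sy Ec; have := odd_len_refl coxS Rc; rewrite Ec.
  elim: (k) => [|j IHj]; first by rewrite len1.
  by rewrite expgS !odd_lenM // (len_gen coxS Sx) (len_gen coxS Sy).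
have odd_case x y : S x -> S y -> c = (x * y) ^+ k * x -> c * x * c = y ->
    (x * y) ^+ k.*2.+1 = 1.
  move=> Sx Sy Ec Exy; have xx := genK coxS Sx.
  have cx : c * x = (x * y) ^+ k by rewrite Ec -mulgA xx mulg1.
  rewrite expgSr -addnn expgnDr mulgA -(mulgA _ _ x) -Ec -{1}cx Exy.
  exact: (genK coxS Sy).
exists k; case: words => Ec.
- by case: (even_st s t).
- by case: (even_st t s).
- exact: odd_case.
have ctc : c * t * c = s by rewrite -csc !mulgA cK mul1g -mulgA cK mulg1.
apply: invg_inj; rewrite -expVgn invgM (genV coxS Ss) (genV coxS St) invg1.
exact: odd_case.
Qed.

End Dihedral.

(** * Consequences of the absence of odd flips *)

Section NoOddFlip.
Context {W : groupType} (S : set W) (coxS : coxeter_system S).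
Context (th : W -> W) (autth : involutive_automorphism S th).
Context (nofth : no_odd_flip S th).
Implicit Types (s t u v w x y z p q g b r c : W).
Local Notation len := (coxeter_length S).
Local Notation refl := (reflections S).
Local Notation desc := (desc S).
Local Notation ldesc := (ldesc S).
Local Notation io := (twisted_identities th).
Local Notation "u <=B w" := (bruhat_le S u w) (at level 70).

Lemma no_odd_flip_expg s k : S s -> (s * th s) ^+ k.*2.+1 = 1 -> s = th s.
Proof.
move=> Ss E; apply: contrapT => /(nofth Ss)[inf|[n [n_gt0 En min_n] even_n]].
  exact: inf E.
have Er : (s * th s) ^+ (k.*2.+1 %% n) = 1.
  by rewrite (divn_eq k.*2.+1 n) expgnDr mulnC expgnA En expg1n mul1g in E.
case: (posnP (k.*2.+1 %% n)) => [/eqP dvd_n|/min_n/(_ Er)].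
  by rewrite (dvdn_odd dvd_n) //= odd_double in even_n.
by rewrite leqNgt ltn_mod n_gt0.
Qed.

(* Conjugating by the longest element h of the parabolic subgroup of {s, th s},
   where s is a descent of c, shortens c unless c normalizes that subgroup. *)
Lemma fixed_reflection c : refl c -> th c = c ->
  exists v r, [/\ S r, th r = r, th v = v & c = v * r * v^-1].
Proof.
have [n le_cn] := ubnP (len c); elim: n c le_cn => // n IHn c le_cn Rc thc.
have cK := reflK coxS Rc; have cV := reflV coxS Rc.
have [s Ss dcs] := exists_desc coxS (refl_neq1 coxS Rc).
have Sts := aut_gen autth Ss; set J := [set s; th s].
have JS : J `<=` S by move=> _ [] ->.
have thJ a : J a -> J (th a).
  by case=> ->; [right|left; rewrite (autK autth)].
have [c1 [h [Ec Ph minR]]] := coset_min_decomposition coxS J c.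
have minc1 : coset_min S J c1.
  by move=> a Ja; apply: minR; [apply/refl_gen/JS|apply: parabolic_gen].
have dcJ a : J a -> desc c a.
  by case=> -> //; rewrite -thc (aut_desc coxS autth).
(* Both elements of [J] are descents of [c], hence of its parabolic factor [h], which is thus the
   longest element. *)
have longh a : J a -> desc h a.
  by move=> Ja; rewrite -(coset_min_descM coxS JS minc1 Ph Ja) -Ec dcJ.
have hh := longest_sqr coxS JS longh Ph; have hV := mulg1_eq hh.
have thh : th h = h.
  apply: (longest_unique coxS JS longh); last exact: aut_len.
  elim/(parabolic_ind (J := J)): Ph => [|g a _ Ja Pg].
    by rewrite (aut1 autth); apply: parabolic1.
  by rewrite (autM autth); apply/(parabolicM Pg)/parabolic_gen/thJ.
have Ehch : h * c * h = h * c1 by rewrite Ec -!mulgA hh mulg1.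
have [lt_hch|le_hch] := ltnP (len (h * c * h)) (len c).
  have Rhch : refl (h * c * h) by rewrite -{2}hV; apply: refl_conj.
  have [||v [r [Sr thr thv Ev]]] := IHn _ _ Rhch.
  - exact: leq_trans lt_hch le_cn.
  - by rewrite !(autM autth) thh thc.
  exists (h * v), r; split=> //; first by rewrite (autM autth) thh thv.
  rewrite invgM hV !mulgA.
  have -> : h * v * r * v^-1 = h * (v * r * v^-1) by rewrite !mulgA.
  by rewrite -Ev !mulgA hh mul1g -mulgA hh mulg1.
(* A left descent of [c1] in [J] would make [h * c * h = h * c1] shorter than [c]. *)
have Nldesc a : J a -> ~~ ldesc c1 a.
  move=> Ja; apply/negP => lac1; have Sa := JS a Ja; move: le_hch; apply/negP.
  rewrite -ltnNge Ehch Ec (coset_min_len coxS JS minc1 Ph) addnC.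
  have -> : h * c1 = h * a * (a * c1) by rewrite !mulgA -(mulgA h) (genK coxS) // mulg1.
  apply: leq_ltn_trans (lenM coxS _ _) _.
  by rewrite -addnS leq_add ?(ltnW (longh a Ja)).
have normJ a : J a -> J (c * a * c).
  move=> Ja; have Sa := JS a Ja.
  have lca : ldesc (c1 * h) a.
    by rewrite -Ec (ldescE coxS _ (refl_gen Sa)) cV dcJ.
  have [b Jb Eb] := coset_min_mull coxS JS minc1 Ph Sa lca (Nldesc a Ja).
  have -> : c * a * c = h * b * h.
    rewrite -{1}cV Ec invgM hV !mulgA -(mulgA _ a) Eb.
    by rewrite -!mulgA mulKg.
  exact: (longest_conj coxS JS longh Ph Jb).
have commuting : s * c = c * s -> c = s by exact: (refl_commuting_desc coxS Rc Ss dcs).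
(* It remains to see that [s] and [c] commute. Outside the parabolic subgroup this is
   [refl_normalizer]; inside, if [c] swaps [s] and [th s], an odd power of [s * th s] is 1, so
   [s = th s]. *)
suff Ecs : c = s.
  by exists 1, s; rewrite mul1g invg1 mulg1 (aut1 autth); split=> //; rewrite -Ecs.
have Js : J s by left.
have [Pc|NPc] := pselect (parabolic J c); last first.
  apply: commuting; rewrite -[in RHS](refl_normalizer coxS JS Rc normJ NPc Js).
  by rewrite -mulgA (genK coxS) // mulg1.
have [csc|csc] := normJ s Js.
  by apply: commuting; rewrite -{1}csc -mulgA cK mulg1.
have [k Ek] := odd_dihedral coxS Ss Sts Rc Pc csc.
apply: commuting; rewrite {1}(no_odd_flip_expg Ss Ek) -csc.
by rewrite -mulgA cK mulg1.
Qed.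

(** For [y = th u * u^-1] the reflection [u^-1 * s * u] is fixed by [th]. Its conjugating element
    [v] from [fixed_reflection] is fixed too, so [u] absorbs it on both sides. *)
Lemma twisted_fixed_mul y s : io y -> S s -> th s * y = y * s ->
  exists u r, S r /\ y * s = th u * r * u^-1.
Proof.
move=> [u _ <-] Ss E; have thM := autM autth.
have Rp : refl (u^-1 * s * u) by rewrite -{2}[u]invgK; apply/refl_conj/refl_gen.
have [|v [r [Sr thr thv Ep]]] := fixed_reflection Rp.
  have := congr1 (fun x => (th u)^-1 * x * u) E; rewrite !thM (autV autth).
  by group_simp.
exists (u * v), r; split=> //.
have -> : s = u * (u^-1 * s * u) * u^-1 by group_simp.
by rewrite Ep thM thv; group_simp.
Qed.

(** Read [b * p] as [th p * b]: multiplying by [th a] on the left shortens it but does not shorten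
    [b], so [coset_min_mull] applies. *)
Lemma twisted_fixed_refl (J : set W) b p a : J `<=` S -> io b -> coset_min S J b ->
  refl p -> parabolic J p -> th p * b = b * p -> J a -> desc p a ->
  exists2 c, J c & th a * b = b * c.
Proof.
move=> JS iob minb Rp Pp Ep Ja dpa; have Sa := JS a Ja.
apply: (coset_min_mull coxS JS minb Pp (aut_gen autth Sa)); last first.
  by rewrite (twisted_ldesc coxS autth) // minb.
rewrite /ldesc -Ep mulgA -(autM autth) Ep (coset_min_len coxS JS minb Pp).
apply: leq_ltn_trans (lenM coxS _ _) _.
rewrite (aut_len coxS autth) addnC ltn_add2l -lenV // invgM (reflV coxS Rp).
by rewrite (genV coxS Sa).
Qed.

(* g |-> b^-1 * th g * b permutes the simple reflections of the parabolic subgroup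
   or p is simple.  If it swaps them, p is the longest element of an odd dihedral
   group and both a and a' are fixed descents of b * p, against uniqueness. *)
Lemma twisted_fixed_simple a a' b p : S a -> S a' -> a <> a' ->
  io b -> coset_min S [set a; a'] b ->
  refl p -> parabolic [set a; a'] p -> th p * b = b * p -> desc p a ->
  (forall c d, S c -> S d -> desc (b * p) c -> desc (b * p) d ->
     th c * (b * p) = b * p * c -> th d * (b * p) = b * p * d -> c = d) ->
  S p \/ forall g, parabolic [set a; a'] g -> th g * b = b * g.
Proof.
set J := [set a; a'] => Sa Sa' aa' iob minb Rp Pp Ep dpa uniq_desc.
have JS : J `<=` S by move=> _ [] ->.
have [Ja Ja'] : J a /\ J a' by split; [left|right].
have pK := reflK coxS Rp; have aK := genK coxS Sa; have aV := genV coxS Sa.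
have thM := autM autth.
have [c [->|->] Ea] := twisted_fixed_refl JS iob minb Rp Pp Ep Ja dpa.
  (* Here the twist fixes [a]. Unless [p = a], the reflection [a * p * a] has the descent [a'], and
     then the twist fixes [a'] as well. *)
  have [->|/eqP pa] := eqVneq p a; [by left|right].
  have Rapa : refl (a * p * a) by rewrite -{2}aV; apply: refl_conj.
  have Papa : parabolic J (a * p * a).
    by rewrite -{2}aV; apply: (parabolic_conj coxS JS) => //; apply: parabolic_gen.
  have Eapa : th (a * p * a) * b = b * (a * p * a).
    by rewrite !thM -mulgA Ea !mulgA -(mulgA _ _ b) Ep mulgA Ea.
  have [a2 Ja2 da2] := parabolic_desc coxS JS Papa (refl_neq1 coxS Rapa).
  have {Ja2} Ea2 : a2 = a'.
    case: Ja2 => // Ea2; have Ra := refl_gen Sa; move: da2; rewrite Ea2.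
    rewrite desc_swap // (descM coxS) // dpa desc_gen //; last exact: refl_conj.
    rewrite /= negbK => /eqP Epap; case: pa.
    apply: (refl_commuting_desc coxS Rp Sa dpa).
    by rewrite -{1}Epap (reflV coxS Rp) -mulgA pK mulg1.
  have [c' [->|->] Ea'] : exists2 c', J c' & th a' * b = b * c'.
    by apply: (twisted_fixed_refl JS iob minb Rapa Papa Eapa Ja'); rewrite -Ea2.
    by case: aa'; apply: (can_inj (autK autth)); apply: (mulIg b); rewrite Ea Ea'.
  move=> g; elim/(parabolic_ind (J := J)) => {g} [|g x _ Jx IHg].
    by rewrite (aut1 autth) mul1g mulg1.
  have Ex : th x * b = b * x by case: Jx => ->.
  by rewrite thM -mulgA Ex !mulgA IHg.
have Ea' : th a' * b = b * a.
  have := congr1 th Ea; rewrite !thM (autK autth) (twisted_inv autth) //.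
  by move=> /(congr1 (fun x => b * x * b)); group_simp.
have longp x : J x -> desc p x.
  case=> -> //; rewrite /desc; have : len (b * (p * a')) < len (b * p).
    rewrite mulgA -Ep -mulgA -Ea mulgA -thM.
    apply: leq_ltn_trans (lenM coxS _ _) _.
    by rewrite (aut_len coxS autth) Ep (coset_min_len coxS JS minb Pp) addnC ltn_add2l.
  rewrite !(coset_min_len coxS JS minb) ?ltn_add2l //.
  by apply: parabolicM => //; apply: parabolic_gen.
(* If [p] commutes with [a], they are equal. Otherwise both [p] and the twist swap [a] and [a'], and
   the two swaps cancel in [b * p]. *)
have [pap|pap] := longest_conj coxS JS longp Pp Ja.
  left; suff -> : p = a by [].
  by apply: (refl_commuting_desc coxS Rp Sa dpa); rewrite -{1}pap -mulgA pK mulg1.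
have Epa : p * a = a' * p by rewrite -pap -mulgA pK mulg1.
have Epa' : p * a' = a * p by rewrite -pap !mulgA pK mul1g.
have dbp x : J x -> desc (b * p) x.
  by move=> Jx; rewrite (coset_min_descM coxS JS minb Pp Jx) longp.
case: aa'; apply: uniq_desc => //; try exact: dbp.
  by rewrite mulgA Ea -!mulgA Epa.
by rewrite mulgA Ea' -!mulgA Epa'.
Qed.

(** Induction on the length of [y]. For a descent [q] of [y], descend to [b] minimal for the
    parabolic subgroup of [s] and [q]; this turns [y * s] into [b * p] with [p] a reflection of that
    subgroup. If [p] is simple, [b] and [p] form a smaller instance. *)
Lemma twisted_below_fixed_asc y s : io y -> S s -> th s * y = y * s ->
  twisted_below S th (y * s) y.
Proof.
have [n le_yn] := ubnP (len y); elim: n y s le_yn => // n IHn y s le_yn ioy Ss E.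
have [y1|/eqP y1] := eqVneq y 1.
  move=> z ioz; rewrite y1 mul1g => /bruhat_le_length[Ez|].
    by have := twisted_even coxS autth ioz; rewrite Ez len_gen.
  by rewrite (len_gen coxS Ss) ltnS leqn0 => /eqP/(len_eq0 coxS) ->; apply: rt_refl.
have [q Sq dyq] := exists_desc coxS y1.
have sq : s <> q.
  move=> Esq; have := twisted_fixed_asc coxS autth ioy Ss E.
  by rewrite Esq dyq.
have JS : [set s; q] `<=` S by move=> _ [] ->.
have [h [b [Ph [iob minb] Ey le_by below]]] := twisted_coset_min coxS autth JS ioy.
have [u [r [Sr Eys]]] := twisted_fixed_mul ioy Ss E.
set p := h^-1 * s * h; have thM := autM autth; have thV := autV autth.
have Rp : refl p by rewrite /p -{2}[h]invgK; apply/refl_conj/refl_gen.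
have Pp : parabolic [set s; q] p.
  rewrite /p -{2}[h]invgK; apply: (parabolic_conj coxS JS) => //.
    exact: (parabolicV coxS JS).
  by apply: parabolic_gen; left.
have Ex : th h^-1 * (y * s) * h = b * p by rewrite Ey /p thV; group_simp.
have Ep : th p * b = b * p.
  have -> : b = th h^-1 * y * h by rewrite Ey thV; group_simp.
  rewrite /p !thM thV; group_simp.
  by rewrite -(mulgA _ (th s)) E; group_simp.
apply: below; rewrite Ex.
have by_ : b <> y.
  by move=> Eby; have := minb q; rewrite Eby dyq => /(_ (or_intror erefl)).
have lt_by : len b < len y by case: le_by.
(* If the twist is trivial on the parabolic subgroup, then h fixes b and y = b. *)
suff [Sp|triv] : S p \/ forall g, parabolic [set s; q] g -> th g * b = b * g.
- by apply: IHn => //; apply: leq_trans lt_by le_yn.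
- by case: by_; rewrite Ey triv // mulgK.
(* By [twisted_fixed_mul], [b * p] is a twisted conjugate of the simple [r], so any such descent is
   one and the same conjugate of [r]. *)
have uniq_desc c d : S c -> S d -> desc (b * p) c -> desc (b * p) d ->
    th c * (b * p) = b * p * c -> th d * (b * p) = b * p * d -> c = d.
  have -> : b * p = th (h^-1 * u) * r * (h^-1 * u)^-1.
    by rewrite -Ex Eys thM; group_simp.
  move=> Sc Sd dc dd Fc Fd.
  rewrite (fixed_desc_unique coxS autth Sr Sc Fc dc).
  by rewrite (fixed_desc_unique coxS autth Sr Sd Fd dd).
have [a [->|->] dpa] := parabolic_desc coxS JS Pp (refl_neq1 coxS Rp).
  exact: (twisted_fixed_simple Ss Sq sq).
rewrite setUC in minb Pp *; apply: (twisted_fixed_simple Sq Ss) dpa uniq_desc => //.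
by move=> qs; apply: sq.
Qed.

End NoOddFlip.

(** * The matching *)

Lemma bruhat_leP (W : groupType) (S : set W) (u w : bruhat S) :
  reflect (bruhat_le S u w) (u <= w)%O.
Proof. exact: asboolP. Qed.

Section Matching.
Context {W : groupType} (S : set W) (coxS : coxeter_system S).
Context (th : W -> W) (autth : involutive_automorphism S th).
Context (nofth : no_odd_flip S th).
Implicit Types (x y z : bruhat S).
Local Notation len := (coxeter_length S).
Local Notation desc := (desc S).
Local Notation io := (twisted_identities th).

Lemma bruhat_lt_len x y : (x < y)%O -> len x < len y.
Proof.
rewrite lt_neqAle => /andP[/eqP xy /bruhat_leP/bruhat_le_length[|]//].
Qed.

Section Descent.
Context (w s : bruhat S) (iow : io w) (Ss : S s) (dws : desc w s).
Local Notation Q := (order_ideal (Br S io) w).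
Let M : bruhat S -> bruhat S := tconj th s.

Let ioM x : io x -> io (M x). Proof. exact: (twisted_tconj coxS autth Ss). Qed.
Let MK x : M (M x) = x. Proof. exact: (tconjK coxS autth Ss x). Qed.

Let M_desc x : io x -> desc x s -> (M x < x)%O.
Proof.
move=> iox dxs; rewrite lt_neqAle; apply/andP; split.
  apply/eqP => E; have : len (M x) < len x.
    by rewrite (len_tconj_desc coxS autth iox Ss dxs) ltnS leqnSn.
  by rewrite E ltnn.
by apply/bruhat_leP; apply: bruhat_tconj_desc.
Qed.

Let M_asc x : io x -> ~~ desc x s -> M x = x \/ (x < M x)%O.
Proof.
move=> iox dxs; have [E|NE] := eqVneq (th s * x) (x * s).
  by left; rewrite /M /tconj E -mulgA (genK coxS Ss) mulg1.
right; rewrite -{1}[x]MK; apply: M_desc; first exact: ioM.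
have Rs := refl_gen Ss.
rewrite -(twisted_ldesc coxS autth (ioM iox) Ss) /ldesc.
rewrite /M /tconj !mulgA (genK coxS (aut_gen autth Ss)) mul1g.
rewrite -mulgA (len_lasc coxS (aut_gen autth Ss) (w := x * s)) //.
by rewrite (twisted_ldesc_mul coxS autth iox Ss) (negPf dxs) /=.
Qed.

Let desc_M x : io x -> (x < M x)%O -> desc (M x) s.
Proof.
move=> iox; apply: contraLR => dMx; case: (M_asc (ioM iox) dMx); rewrite MK.
  by move=> <-; rewrite ltxx.
by move=> lt_Mx; apply/negP => /(lt_trans lt_Mx); rewrite ltxx.
Qed.

Let M_fixed x : io x -> ~~ desc x s -> M x = x -> th s * x = x * s.
Proof.
move=> iox dxs E.
by rewrite -{2}E /M /tconj -!mulgA (genK coxS Ss) mulg1.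
Qed.

Let Q_below x y : io x -> Q y -> (x <= y)%O -> Q x.
Proof. by move=> iox [_ yw] xy; split=> //; apply: le_trans yw. Qed.

Let M_fun x : Q x -> Q (M x).
Proof.
move=> [iox /bruhat_leP xw]; split; first exact: ioM.
apply/bruhat_leP; case: (boolP (desc x s)) => dxs.
  apply: rt_trans (bruhat_tconj_desc coxS autth iow Ss dws).
  exact: bruhat_tconj2_desc.
by apply: bruhat_tconj2 => //; apply: bruhat_tconj_asc.
Qed.

(** Twisted identities have even length and [M x] is two shorter than [x], which leaves no room in
    between. *)
Let covers_M x : Q x -> io x -> desc x s -> covers Q (M x) x.
Proof.
move=> Qx iox dxs; split=> //; [exact: M_fun|exact: M_desc|].
move=> [z [[ioz _] /bruhat_lt_len lt_z /bruhat_lt_len]].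
rewrite (len_tconj_desc coxS autth iox Ss dxs) ltnS => le_z.
have Ez : len z = (len (M x)).+1 by apply/eqP; rewrite eqn_leq le_z.
have := twisted_even coxS autth ioz; rewrite Ez /= negbK.
by apply/negP/(twisted_even coxS autth)/ioM.
Qed.

Lemma twisted_matching : special_partial_matching Q M.
Proof.
have Qw : Q w by split.
split.
- by move=> x; apply: M_fun.
- by move=> x _; apply: MK.
- by exists w; [split=> // y []|apply: covers_M].
- move=> x Qx; have [iox _] := Qx; case: (boolP (desc x s)) => dxs.
    by constructor 1; apply: covers_M.
  case: (M_asc iox dxs) => [|lt_x]; first by constructor 2.
  constructor 3; rewrite -{1}[x]MK; apply: covers_M; [exact: M_fun|exact: ioM|].
  exact: desc_M.
move=> x y [[iox _] [ioy Qy] lt_xy Nz] Mxy.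
have Mxy' : M x != M y.
  by apply/eqP => /(congr1 M); rewrite !MK => E; rewrite E ltxx in lt_xy.
have le_xy := ltW lt_xy; have /bruhat_leP xy := le_xy.
case: (boolP (desc x s)) => dxs.
  case: (boolP (desc y s)) => dys.
    rewrite lt_neqAle Mxy'; apply/bruhat_leP; exact: bruhat_tconj2_desc.
  apply: lt_trans (M_desc iox dxs) _; case: (M_asc ioy dys) => [->//|].
  exact: lt_trans.
case: (boolP (desc y s)) => dys.
  (* Lifting gives [x <= M y < y]; as [y] covers [x], this forces [x = M y], which is excluded. *)
  have le_x : (x <= M y)%O by apply/bruhat_leP; apply: bruhat_tconj_asc.
  case: Nz; exists (M y); split; last exact: M_desc.
    by apply: Q_below (ioM ioy) (conj ioy Qy) (ltW _); apply: M_desc.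
  rewrite lt_neqAle le_x andbT; apply/eqP => E; case: Mxy.
  by rewrite E MK.
case: (M_asc iox dxs) => [E|_].
  by rewrite E; case: (M_asc ioy dys) => [->//|]; apply: lt_trans.
rewrite lt_neqAle Mxy'; apply/bruhat_leP.
case: (M_asc ioy dys) => [E|lt_y].
  (* Lifting yields only [M x <= y * s]; being a twisted identity, [M x] is then below [y]. *)
  rewrite E; apply: (twisted_below_fixed_asc coxS autth nofth ioy Ss).
  - exact: M_fixed.
  - exact: ioM.
  have Rs := refl_gen Ss; rewrite /M /tconj -mulgA.
  apply: (bruhat_mull_desc coxS (aut_gen autth Ss)).
    by apply: bruhat_mulr2 => //; rewrite dys orbT.
  by rewrite (twisted_ldesc_mul coxS autth ioy Ss) (negPf dys) (M_fixed ioy dys E) eqxx.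
apply: (bruhat_tconj2 coxS autth (ioM ioy) Ss); first exact: desc_M.
by rewrite -/(M _) MK.
Qed.
End Descent.
End Matching.

Theorem theorem7p1 (W : groupType) (S : set W) (theta : W -> W)
    (coxWS : coxeter_system S)
    (autTheta : involutive_automorphism S theta)
    (nofTheta : no_odd_flip S theta) :
  pircon (Br S (twisted_identities theta)).
Proof.
move=> w [iow [v _ /bruhat_lt_len lt_vw]]; split.
  apply: sub_finite_set (finite_bruhat_interval coxWS w).
  by move=> u [_ /bruhat_leP].
have [|s Ss dws] := exists_desc coxWS (w := w).
  by move=> E; rewrite E len1 in lt_vw.
by exists (tconj theta s); apply: twisted_matching.
Qed.
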